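(* Let $G$ be a $4$-critical non-complete graph with $n(G)$ vertices and $m(G)$ edges. Then $G$ contains at most $m(G)/2$ double-critical edges. Moreover, $G$ contains precisely $m(G)/2$ double-critical edges if and only if $G$ contains a vertex $v$ of degree $n(G)-1$ such that $G-v$ is an odd cycle of length at least $5$.
   Context: All graphs are finite and simple. A graph is $4$-critical if it is $4$-chromatic and $\chi(G-v)<\chi(G)$ for every vertex $v$. An edge $xy$ of $G$ is double-critical if $\chi(G-x-y)=\chi(G)-2$. *)

(* Defs.v *)
(* A finite simple graph is a symmetric irreflexive relation
   e on a finType V. *)
From mathcomp Require Import all_boot.
Set Implicit Arguments. Unset Strict Implicit. Unset Printing Implicit Defensive.

Section Graphs.
Variables (V : finType) (e : rel V).

(* S (the induced subgraph G[S]) admits a proper colouring with colours < k.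
   Colours are taken in 'I_(#|V|.+1), which loses nothing since k <= #|V|
   always suffices. *)
Definition colorable (S : {set V}) (k : nat) : bool :=
  [exists f : {ffun V -> 'I_(#|V|.+1)},
     [forall x in S, f x < k] &&
     [forall x in S, forall y in S, e x y ==> (f x != f y)]].

(* chromatic number of the induced subgraph G[S]: least k <= #|V| such that
   G[S] is k-colourable (#|V| colours always suffice). *)
Definition chi (S : {set V}) : nat := find (colorable S) (iota 0 #|V|.+1).

Definition chiG : nat := chi [set: V].

Definition critical4 : Prop :=
  chiG = 4 /\ forall v : V, chi ([set: V] :\ v) < chiG.

Definition edges : {set {set V}} := [set [set x; y] | x in V, y in V & e x y].
Definition m : nat := #|edges|.
Definition n : nat := #|V|.
Definition deg (v : V) : nat := #|[set w | e v w]|.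

Definition double_critical (x y : V) : bool :=
  e x y && (chi ([set: V] :\ x :\ y) == chiG - 2).

Definition dc_edges : {set {set V}} :=
  [set E in edges | [exists x, exists y, (E == [set x; y]) && double_critical x y]].

Definition complete : Prop := forall x y : V, x != y -> e x y.

Definition induced_cycle (S : {set V}) (s : seq V) : Prop :=
  [/\ uniq s, 3 <= size s, S =i s &
      forall x y, x \in S -> y \in S -> e x y = (y == next s x) || (x == next s y)].

Definition odd_cycle_ge5 (S : {set V}) : Prop :=
  exists s : seq V, induced_cycle S s /\ odd (size s) /\ 5 <= size s.

End Graphs.

(* Main.v *)
(* If two double-critical edges xy and zw are disjoint, then so are the
   2-colourings f of G - x - y and g of G - z - w, and were xz a non-edge, the
   values of f and g together would determine a 3-colouring of G; hence
   {x, y, z, w} spans a K4 and G is complete. So the double-critical edges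
   pairwise meet, and they lie in a triangle or in a star. In a triangle there
   are at most three, too few because all degrees are at least 3. In a star
   centred at v, every double-critical neighbour of v lies on every odd cycle C
   of G - v, so their number is at most both deg v and |C|, while the deg v
   edges at v and the |C| edges of C are distinct. Equality forces G to
   be the wheel with hub v and rim C. *)
Require Import Defs.
From mathcomp Require Import all_boot.

Set Implicit Arguments. Unset Strict Implicit. Unset Printing Implicit Defensive.

(** * Colourings with natural or boolean colours, and the chromatic number *)

Section Colouring.
Variables (V : finType) (e : rel V).

(** Colours below [k <= #|V|] fit into ['I_(#|V|.+1)], so [inord] loses nothing and colours can be
    plain natural numbers. *)
Lemma colorableP (S : {set V}) k : k <= #|V| ->
  reflect (exists c : V -> nat, (forall x, x \in S -> c x < k) /\
             {in S &, forall x y, e x y -> c x != c y}) (colorable e S k).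
Proof.
move=> kV; apply: (iffP existsP) => [[f /andP[/forall_inP fk /forall_inP fP]]|].
  exists (fun x => nat_of_ord (f x)); split=> [|x y xS yS exy]; first exact: fk.
  by have /forall_inP/(_ y yS)/implyP/(_ exy) := fP x xS.
case=> c [ck cP]; exists [ffun x => inord (c x)].
have cE x : x \in S -> (inord (c x) : 'I_#|V|.+1) = c x :> nat.
  by move=> xS; rewrite inordK // (leq_trans (ck x xS)) // leqW.
apply/andP; split; apply/forall_inP => x xS; first by rewrite ffunE cE ?ck.
apply/forall_inP => y yS; apply/implyP => exy.
by rewrite !ffunE -(inj_eq val_inj) /= !cE // cP.
Qed.

Lemma colorable_leq (S : {set V}) j k :
  j <= k -> k <= #|V| -> colorable e S j -> colorable e S k.
Proof.
move=> jk kV /colorableP[|c [cj cP]]; first exact: leq_trans jk kV.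
by apply/colorableP => //; exists c; split=> // x /cj /leq_trans; apply.
Qed.

(** With boolean colours, alternation along a path and the swap of the two colours both become
    [(+)]. *)
Lemma colorable2P (S : {set V}) : 2 <= #|V| ->
  reflect (exists f : V -> bool, {in S &, forall x y, e x y -> f x != f y})
          (colorable e S 2).
Proof.
move=> V2; apply: (iffP (colorableP _ V2)) => [[c [c2 cP]]|[f fP]].
  exists (fun x => c x == 1) => x y xS yS /(cP x y xS yS).
  by move: (c2 x xS) (c2 y yS); case: (c x) (c y) => [|[]] // [|[]].
exists (fun x => nat_of_bool (f x)); split=> [x _|x y xS yS /(fP x y xS yS)]; first by case: (f x).
by case: (f x) (f y) => [] [].
Qed.

Hypothesis e_irr : irreflexive e.

Lemma colorable_card (S : {set V}) : colorable e S #|V|.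
Proof.
apply/colorableP => //; exists (fun x => nat_of_ord (enum_rank x)); split=> [x _|x y _ _ exy].
  by rewrite ltn_ord.
by apply: contraTneq exy => /val_inj/enum_rank_inj->; rewrite e_irr.
Qed.

(** Colourability is monotone in [k] and holds at [#|V|], so the first success found by [chi] is a
    threshold. Through this lemma the chromatic conditions below turn into colourings. *)
Lemma chi_leq (S : {set V}) k : k <= #|V| -> (chi e S <= k) = colorable e S k.
Proof.
move=> kV; rewrite /chi.
have hasV : has (colorable e S) (iota 0 #|V|.+1).
  by apply/hasP; exists #|V|; rewrite ?colorable_card // mem_iota ltnSn.
have ltf := hasV; rewrite has_find size_iota in ltf.
have := nth_find 0 hasV; rewrite nth_iota // add0n => colf.
apply/idP/idP => [le_k|colk]; first exact: colorable_leq colf.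
rewrite leqNgt; apply/negP => lt_k; have := before_find 0 lt_k.
by rewrite nth_iota ?add0n ?colk // ltnS.
Qed.

Lemma colorable_add (S : {set V}) x k : k < #|V| ->
  colorable e (S :\ x) k -> colorable e S k.+1.
Proof.
move=> kV /colorableP[|c [ck cP]]; first exact: ltnW.
apply/colorableP => //; exists (fun y => if y == x then k else c y).
have lt_ck y : y \in S -> y != x -> c y < k by move=> yS yx; rewrite ck // !inE yx.
split=> [y yS|y z yS zS eyz].
  by case: (eqVneq y x) => // yx; rewrite ltnS ltnW // lt_ck.
case: (eqVneq y x) => [yx|yx]; case: (eqVneq z x) => [zx|zx].
- by rewrite yx zx e_irr in eyz.
- by rewrite gtn_eqF // lt_ck.
- by rewrite ltn_eqF // lt_ck.
- by apply: cP; rewrite ?inE ?yx ?zx.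
Qed.

End Colouring.

(** * Parity along paths and cycles, and the edge set of a cycle *)

Lemma path_alternates (T : Type) (f : T -> bool) x p :
  path (fun y z => f y != f z) x p -> f (last x p) = f x (+) odd (size p).
Proof.
elim: p x => [|y p IHp] x /=; first by rewrite addbF.
by case/andP=> fxy /IHp->; case: (f x) (f y) fxy => [] [] // _; case: odd.
Qed.

Lemma alternating_cycle_even (T : Type) (f : T -> bool) s :
  cycle (fun y z => f y != f z) s -> ~~ odd (size s).
Proof.
case: s => [//|x p] /(@path_alternates _ f x); rewrite last_rcons size_rcons /=.
by case: (f x) (odd _) => [] [].
Qed.

(** This makes the edges of a cycle distinct: if [[set x; next s x]] equalled [[set y; next s y]]
    with [x != y], two steps from [x] would lead back to [x]. *)
Lemma next_next_neq (T : eqType) (s : seq T) x :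
  uniq s -> 3 <= size s -> x \in s -> next s (next s x) != x.
Proof.
move=> Us s3 /rot_to[i s' rs]; rewrite -!(next_rot i Us).
move: Us s3; rewrite -(rot_uniq i) -(size_rot i s) rs.
case: s' {rs} => [|a [|b s']] //= /andP[+ /andP[_ _]] _.
rewrite !inE !negb_or => /and3P[xa xb _].
by rewrite eqxx [a == x]eq_sym (negPf xa) eqxx eq_sym.
Qed.

Definition cycle_edges (T : finType) (s : seq T) : {set {set T}} :=
  [set [set x; next s x] | x in s].

Lemma set2_eq (T : finType) (a b c d : T) : [set a; b] = [set c; d] ->
  (a = c /\ b = d) \/ (a = d /\ b = c).
Proof.
move=> E.
have /set2P A : a \in [set c; d] by rewrite -E set21.
have /set2P B : b \in [set c; d] by rewrite -E set22.
have /set2P C : c \in [set a; b] by rewrite E set21.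
have /set2P D : d \in [set a; b] by rewrite E set22.
by case: A; case: B; case: C; case: D => *; subst; auto.
Qed.

Lemma card_cycle_edges (T : finType) (s : seq T) :
  uniq s -> 3 <= size s -> #|cycle_edges s| = size s.
Proof.
move=> Us s3; rewrite card_in_imset ?(card_uniqP Us) // => x y xs ys.
case/set2_eq => [[]//|[xE yE]]; have := next_next_neq Us s3 xs.
by rewrite yE -xE eqxx.
Qed.

(** * Odd cycles as the obstruction to 2-colouring *)

Section OddCycle.
Variables (V : finType) (e : rel V).
Hypotheses (e_sym : symmetric e) (e_irr : irreflexive e).

Lemma odd_cycle_uncolorable (S : {set V}) s : 2 <= #|V| ->
  cycle e s -> odd (size s) -> {subset s <= S} -> ~~ colorable e S 2.
Proof.
move=> V2 es odds sS; apply/(colorable2P _ _ V2) => -[f fP].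
suff: cycle (fun y z => f y != f z) s by move/alternating_cycle_even; rewrite odds.
apply: (sub_in_cycle (P := mem s)) es; last exact/allP.
by move=> x y /sS xS /sS yS; apply: fP.
Qed.

(* If no two neighbours of [u] in one component of [S - u] had different
   colours, swapping colours componentwise would free a colour for [u]. *)
Lemma odd_cycle_exists (S : {set V}) u : 2 <= #|V| ->
  colorable e (S :\ u) 2 -> ~~ colorable e S 2 ->
  exists s, [/\ uniq s, cycle e s, odd (size s), 3 <= size s & {subset s <= S}].
Proof.
move=> V2 /colorable2P[//|f fP] nc.
pose r := [rel x y | [&& x \in S :\ u, y \in S :\ u & e x y]].
have r_sym : connect_sym r.
  by apply: sym_connect_sym => x y /=; rewrite e_sym andbCA.
have uS : u \in S.
  apply: contraNT nc => uS; apply/colorable2P => //; exists f => x y xS yS.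
  by apply: fP; rewrite !inE ?xS ?yS ?andbT; apply: contraNneq uS => <-.
pose nbr a := (a \in S) && e u a.
have nbrS a : nbr a -> a \in S :\ u.
  by case/andP=> aS eua; rewrite !inE aS andbT; apply: contraTneq eua => ->; rewrite e_irr.
have [/existsP[a /existsP[b /and5P[na nb /connectP[p rp bE] fa fb]]] | none] := boolP
  [exists a, exists b, [&& nbr a, nbr b, connect r a b, ~~ f a & f b]].
  (* A simple path in [S - u] between neighbours of [u] with different colours has an odd number of
     edges; closing it through [u] adds two. *)
  case/shortenP: rp bE => q rq Uq _ bE.
  have qS : {subset a :: q <= S :\ u}.
    move=> x; rewrite inE => /predU1P[->|]; first exact: nbrS.
    elim: q a rq {na nb Uq bE fa} => //= y q IHq a /andP[/and3P[_ yS _] rq].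
    by rewrite inE => /predU1P[->//|]; apply: IHq rq.
  have oddq : odd (size q).
    have altq : path (fun y z => f y != f z) a q.
      by apply: sub_path rq => x y /= /and3P[xS yS exy]; apply: fP.
    by have := path_alternates altq; rewrite -bE fb (negPf fa); case: odd.
  exists [:: u, a & q]; split.
  - by rewrite cons_uniq Uq andbT; apply/negP => /qS; rewrite !inE eqxx.
  - have /andP[_ eua] := na; have /andP[_ eub] := nb.
    rewrite /= eua rcons_path -bE e_sym eub andbT.
    by apply: sub_path rq => x y /= /and3P[].
  - by rewrite /= oddq.
  - by case: (q) oddq.
  - by move=> x; rewrite inE => /predU1P[->//|/qS]; rewrite !inE => /andP[].
case/colorable2P: nc => //.
(* [h] marks the components containing a neighbour of [u] coloured [true]. Swapping exactly there
   makes every neighbour of [u] [false], and [u] can be [true]. *)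
pose h x := [exists a, [&& nbr a, connect r x a & f a]].
exists (fun x => (x == u) || (x != u) && (f x (+) h x)).
have hN a : nbr a -> h a = f a.
  move=> na; apply/existsP/idP => [[b /and3P[nb ab fb]]|fa].
    apply: contraNT none => fa; apply/existsP; exists a; apply/existsP; exists b.
    exact/and5P.
  by exists a; rewrite na connect0.
move=> x y xS yS exy.
case: (eqVneq x u) => [xu|xu]; case: (eqVneq y u) => [yu|yu] /=.
- by rewrite xu yu e_irr in exy.
- by rewrite hN ?addbb // /nbr yS -xu.
- by rewrite hN ?addbb // /nbr xS e_sym -yu.
have rxy : r x y by rewrite /= !inE xu yu xS yS.
have -> : h x = h y.
  by apply: eq_existsb => a; rewrite (same_connect r_sym (@connect1 _ r _ _ rxy)).
have : f x != f y by apply: fP; rewrite // !inE ?xu ?yu.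
by case: (f x) (f y) (h y) => [] [] [].
Qed.

End OddCycle.

(** * Basic properties of 4-critical graphs: degrees, order, K4 subgraphs *)

Section Critical4.
Variables (V : finType) (e : rel V).
Hypotheses (e_sym : symmetric e) (e_irr : irreflexive e) (crit : critical4 e).

Lemma edge_neq x y : e x y -> x != y.
Proof. by apply: contraTneq => ->; rewrite e_irr. Qed.

Lemma critical4_order : 4 <= #|V|.
Proof. by case: crit => <- _; rewrite chi_leq ?colorable_card. Qed.
Let V4 := critical4_order.
Let V3 : 3 <= #|V| := ltnW V4.
Let V2 : 2 <= #|V| := ltnW V3.

Lemma critical4_uncolorable : ~~ colorable e setT 3.
Proof. by rewrite -chi_leq // -ltnNge; case: crit => [+ _]; rewrite /chiG => ->. Qed.

Lemma critical4_colorable v : colorable e (setT :\ v) 3.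
Proof. by case: crit => [E /(_ v)]; rewrite E ltnS chi_leq. Qed.

(** Only the upper bound on the chromatic number of G - x - y matters: were it at most 1, putting
    back [x] and [y] with a new colour each would 3-colour G. *)
Lemma double_criticalE x y :
  double_critical e x y = e x y && colorable e (setT :\ x :\ y) 2.
Proof.
rewrite /double_critical; have [-> _] := crit; congr (_ && _).
rewrite eqn_leq chi_leq // -[RHS]andbT; congr (_ && _); rewrite ltnNge chi_leq ?(ltnW V2) //.
apply: contra critical4_uncolorable => c1.
exact: (colorable_add e_irr V3 (colorable_add e_irr V2 c1)).
Qed.

Lemma double_critical_sym x y : double_critical e x y = double_critical e y x.
Proof. by rewrite !double_criticalE e_sym !setDDl setUC. Qed.

Lemma deg_ge3 v : 3 <= deg e v.
Proof.
rewrite leqNgt; apply/negP => dv.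
have /colorableP[//|c [c3 cP]] := critical4_colorable v.
have /hasP[k + kN] : has (fun k => k \notin [seq c w | w in [set w | e v w]]) (iota 0 3).
  rewrite has_predC; apply: contraL dv => /allP sub.
  by rewrite -leqNgt /deg -(size_image c) -(size_iota 0 3) uniq_leq_size // iota_uniq.
rewrite mem_iota add0n => k3; case/negP: critical4_uncolorable.
have kc w : e v w -> k != c w.
  by move=> evw; apply: contraNneq kN => ->; apply: image_f; rewrite inE.
apply/colorableP => //; exists (fun x => if x == v then k else c x).
split=> [x _|x y _ _ exy]; first by case: (eqVneq x v) => // xv; rewrite c3 // !inE xv.
case: (eqVneq x v) => [xv|xv]; case: (eqVneq y v) => [yv|yv].
- by rewrite xv yv e_irr in exy.
- by apply: kc; rewrite -xv.
- by rewrite eq_sym; apply: kc; rewrite -yv e_sym.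
- by apply: cP; rewrite // !inE ?xv ?yv.
Qed.

Lemma full_degree v w : #|V|.-1 <= deg e v -> w != v -> e v w.
Proof.
move=> dv wv; have /eqP E : [set w | e v w] == ~: [set v].
  rewrite eqEcard cardsC1 dv andbT; apply/subsetP => u.
  by rewrite !inE eq_sym; apply: edge_neq.
by have := in_setC1 w v; rewrite -E inE wv.
Qed.

Lemma order4_complete : #|V| <= 4 -> complete e.
Proof.
move=> n4 x y xy; apply: full_degree; last by rewrite eq_sym.
by apply: leq_trans (deg_ge3 x); case: #|V| n4.
Qed.

(** A vertex [u] outside the K4 would leave it inside the 3-colourable graph G - u; hence there are
    only four vertices. *)
Lemma K4_complete x y z w :
  e x y -> e x z -> e x w -> e y z -> e y w -> e z w -> complete e.
Proof.
move=> exy exz exw eyz eyw ezw; apply: order4_complete.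
pose s := [:: x; y; z; w].
suff sT : V \subset s by apply: leq_trans (subset_leq_card sT) (card_size s).
apply/subsetP => u _; apply/negPn/negP => us.
have /colorableP[//|c [c3 cP]] := critical4_colorable u.
have sT v : v \in s -> v \in [set: V] :\ u.
  by move=> vs; rewrite !inE andbT; apply: contraNneq us => <-.
have c_neq v v' : v \in s -> v' \in s -> e v v' -> c v != c v'.
  by move=> /sT vs /sT v's; apply: cP.
suff: size (map c s) <= size (iota 0 3) by [].
apply: uniq_leq_size => [|_ /mapP[v /sT vs ->]]; last by rewrite mem_iota c3.
by rewrite /= !inE !negb_or !c_neq // !inE eqxx ?orbT.
Qed.

(** * Any two double-critical edges meet *)

Lemma disjoint_double_critical x y z w :
  double_critical e x y -> double_critical e z w ->
  x != z -> x != w -> y != z -> y != w -> e x z.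
Proof.
rewrite !double_criticalE => /andP[exy /colorable2P[//|f fP]].
case/andP=> ezw /colorable2P[//|g gP] xz xw yz yw.
have xy : x != y by apply: contraTneq exy => ->; rewrite e_irr.
have zw : z != w by apply: contraTneq ezw => ->; rewrite e_irr.
apply: contraNT critical4_uncolorable => nexz.
(* Class 0 is [y] with vertices that agree with [y] in [g]; class 1 is [w] with vertices that agree
   with [w] in [f]. The others in class 2 agree with [x] in [g] and with [z] in [f], so they are
   adjacent to neither, and [x], [z] are non-adjacent by assumption. *)
pose c u := if u \in [:: x; z] then 2 else if u == y then 0 else if u == w then 1
  else if g u != g x then 0 else if f u != f z then 1 else 2.
apply/colorableP => //; exists c; split=> [u _|]; first by rewrite /c; do 5!case: ifP => //.
have fE a b : [&& a != x, a != y, b != x, b != y & e a b] -> f b = ~~ f a.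
  case/and5P=> ax ay bx b_y eab; have : f a != f b by apply: fP; rewrite ?inE ?ax ?ay ?bx ?b_y.
  by case: (f a) (f b) => [] [].
have gE a b : [&& a != z, a != w, b != z, b != w & e a b] -> g b = ~~ g a.
  case/and5P=> az aw bz bw eab; have : g a != g b by apply: gP; rewrite ?inE ?az ?aw ?bz ?bw.
  by case: (g a) (g b) => [] [].
have fw : f w = ~~ f z by apply: fE; rewrite ![z == _]eq_sym ![w == _]eq_sym xz yz xw yw ezw.
have gy : g y = ~~ g x by apply: gE; rewrite xz xw yz yw exy.
have cP a b : a \in [:: x; y; z; w] -> e a b -> c a != c b.
  have cE u : u != x -> u != z -> u != y -> u != w ->
      c u = if g u != g x then 0 else if f u != f z then 1 else 2.
    by rewrite /c !inE => /negPf-> /negPf-> /negPf-> /negPf->.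
  have cx : c x = 2 by rewrite /c !inE eqxx.
  have cz : c z = 2 by rewrite /c !inE eqxx orbT.
  have cy : c y = 0 by rewrite /c !inE eq_sym (negPf xy) (negPf yz) eqxx.
  have cw : c w = 1.
    by rewrite /c !inE ![w == _]eq_sym (negPf xw) (negPf zw) (negPf yw) eqxx.
  have nezx : e z x = false by rewrite e_sym (negPf nexz).
  have cbE := (cx, cy, cz, cw, e_irr, negPf nexz, nezx).
  rewrite !inE => /or4P[] /eqP->;
    (case: (eqVneq b x) => [->|bx]; first by rewrite ?cbE);
    (case: (eqVneq b y) => [->|b_y]; first by rewrite ?cbE);
    (case: (eqVneq b z) => [->|bz]; first by rewrite ?cbE);
    (case: (eqVneq b w) => [->|bw]; first by rewrite ?cbE);
    move=> eab; rewrite ?cbE (cE b) //.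
  (* The four remaining goals are edges from [x], [y], [z], [w] to a vertex [b] outside them: [g] is
     proper at [x] and [y], [f] at [z] and [w]. *)
  - by rewrite (gE x b) ?xz ?xw ?bz ?bw //; case: (g x).
  - by rewrite (gE y b) ?yz ?yw ?bz ?bw // gy; case: (g x) (f b) (f z) => [] [] [].
  - rewrite (fE z b) 1?[z == _]eq_sym ?xz ?[z == y]eq_sym ?yz ?bx ?b_y //.
    by case: (g b) (g x) (f z) => [] [] [].
  - rewrite (fE w b) 1?[w == _]eq_sym ?xw ?[w == y]eq_sym ?yw ?bx ?b_y // fw.
    by case: (g b) (g x) (f z) => [] [] [].
move=> a b _ _ eab.
have [aS|] := boolP (a \in [:: x; y; z; w]); first exact: cP.
have [bS _|] := boolP (b \in [:: x; y; z; w]); first by rewrite eq_sym cP // e_sym.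
rewrite !inE !negb_or => /and4P[bx b_y bz bw] /and4P[ax ay az aw].
have := fE a b; have := gE a b.
rewrite /c !inE !(negPf bx, negPf b_y, negPf bz, negPf bw, negPf ax, negPf ay, negPf az, negPf aw) eab /=.
by move=> -> // -> //; case: (f a) (g a) (f z) (g x) => [] [] [] [].
Qed.

Hypothesis nc : ~ complete e.

Lemma noncomplete_order : 5 <= #|V|.
Proof. by rewrite ltnNge; apply/negP => /order4_complete. Qed.

Lemma double_critical_meet x y z w :
  double_critical e x y -> double_critical e z w ->
  [|| x == z, x == w, y == z | y == w].
Proof.
move=> xy zw; apply/negPn/negP; rewrite !negb_or => /and4P[xz xw yz yw].
(* Reversing either edge gives all four cross edges of the K4. *)
have [yx wz] := (xy, zw); rewrite double_critical_sym in yx; rewrite double_critical_sym in wz.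
have exy : e x y by case/andP: xy.
have ezw : e z w by case/andP: zw.
by case: nc; apply: (@K4_complete x y z w) => //;
  [apply: disjoint_double_critical xy zw _ _ _ _
  |apply: disjoint_double_critical xy wz _ _ _ _
  |apply: disjoint_double_critical yx zw _ _ _ _
  |apply: disjoint_double_critical yx wz _ _ _ _].
Qed.

(** * Edge sets and stars; double-critical edges inside a triangle *)

Lemma edgesP E : reflect (exists x y, E = [set x; y] /\ e x y) (E \in edges e).
Proof.
apply: (iffP imset2P) => [[x y _]|[x [y [-> exy]]]].
  by rewrite inE => /andP[_ exy] ->; exists x, y.
by exists x y => //; rewrite inE.
Qed.

Lemma dc_edgesP E :
  reflect (exists x y, E = [set x; y] /\ double_critical e x y) (E \in dc_edges e).
Proof.
apply: (iffP idP) => [|[x [y [-> dxy]]]]; rewrite inE.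
  by case/andP=> _ /existsP[x /existsP[y /andP[/eqP-> dxy]]]; exists x, y.
apply/andP; split; first by apply/edgesP; exists x, y; case/andP: dxy.
by apply/existsP; exists x; apply/existsP; exists y; rewrite eqxx.
Qed.

Lemma dc_edges_sub : dc_edges e \subset edges e.
Proof. by apply/subsetP => E; rewrite inE => /andP[]. Qed.

Definition star v : {set {set V}} := [set [set v; w] | w in [set w | e v w]].

Lemma set2_inj v : injective (fun w : V => [set v; w]).
Proof. by move=> w w' /set2_eq[[]//|[-> ->]]. Qed.

Lemma card_star v : #|star v| = deg e v.
Proof. by rewrite card_imset //; apply: set2_inj. Qed.

Lemma star_edges v : star v \subset edges e.
Proof.
apply/subsetP => E /imsetP[w]; rewrite inE => evw ->.
by apply/edgesP; exists v, w.
Qed.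

Lemma mem_star v E : E \in edges e -> (E \in star v) = (v \in E).
Proof.
move=> /edgesP[x [y [-> exy]]]; apply/idP/idP => [/imsetP[w _ ->]|/set2P[->|->]].
- by rewrite set21.
- by apply: imset_f; rewrite inE.
- by rewrite setUC; apply: imset_f; rewrite inE e_sym.
Qed.

(** Two vertices outside [T] are incident with at least 3 + 3 - 1 edges, none double-critical, while
    [T] contains at most three pairs. Strictness excludes equality in this case. *)
Lemma dc_edges_triangle (T : {set V}) :
  #|T| <= 3 -> {in dc_edges e, forall E : {set V}, E \subset T} -> 2 * #|dc_edges e| < m e.
Proof.
move=> T3 DT.
have D3 : #|dc_edges e| <= 3.
  have : dc_edges e \subset [set E : {set V} | E \subset T & #|E| == 2].
    apply/subsetP => E ED; rewrite inE DT //=.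
    have /dc_edgesP[x [y [-> /andP[exy _]]]] := ED.
    by rewrite cards2 edge_neq.
  move/subset_leq_card/leq_trans; apply; rewrite cards_draws.
  by case: #|T| T3 => [|[|[|[]]]].
have /card_gt1P[u [w [uT wT uw]]] : 1 < #|~: T|.
  rewrite -(leq_add2l #|T|) cardsC; apply: leq_trans noncomplete_order.
  by rewrite -[5]/(3 + 2) leq_add2r.
have starI : #|star u :&: star w| <= 1.
  rewrite -(cards1 [set u; w]); apply/subset_leq_card/subsetP => E.
  rewrite !inE => /andP[/imsetP[a _ ->] /imsetP[b _ /set2_eq[[uE]|[_ ->]]]] //.
  by rewrite uE eqxx in uw.
have starU : 5 <= #|star u :|: star w|.
  rewrite cardsU !card_star leq_subRL; last first.
    by rewrite (leq_trans starI) // ltn_addr // ltnW // ltnW // deg_ge3.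
  apply: leq_trans (_ : 3 + 3 <= _); last by rewrite leq_add ?deg_ge3.
  by rewrite -[3 + 3]/(1 + 5) leq_add2r.
have disj : (star u :|: star w) :&: dc_edges e = set0.
  apply/setP => E; rewrite !inE andbC; apply/negP => /andP[/andP[EE Ed]].
  have /DT/subsetP ET : E \in dc_edges e by rewrite inE EE.
  rewrite -![_ \in [set _ | _ in _]]/(E \in star _) !mem_star //.
  by case/orP=> /ET; apply/negP; rewrite -in_setC.
have : #|star u :|: star w| + #|dc_edges e| <= m e.
  rewrite -cardsUI disj cards0 addn0 subset_leq_card //.
  by rewrite !subUset !star_edges dc_edges_sub.
apply: leq_trans; rewrite mul2n -addnn -addSn leq_add2r.
by rewrite (leq_trans _ starU) // ltnS (leq_trans D3).
Qed.

(** * Double-critical edges in a star, and wheels *)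

Lemma cycle_edges_sub s : cycle e s -> cycle_edges s \subset edges e.
Proof.
move=> es; apply/subsetP => E /imsetP[x xs ->]; apply/edgesP.
by exists x, (next s x); rewrite next_cycle.
Qed.

Lemma star_cycle_disjoint v s : v \notin s -> [disjoint star v & cycle_edges s].
Proof.
move=> vs; rewrite disjoint_subset; apply/subsetP => E /imsetP[w _ ->].
rewrite inE; apply/imsetP => -[x xs /setP/(_ v)]; rewrite set21 => /esym/set2P.
by case=> vE; move: vs; rewrite vE ?mem_next xs.
Qed.

(** Counting gives that the neighbours of [v] are exactly the vertices of [s]. Any other vertex
    would have an edge that is neither spoke nor rim edge, and a chord of [s] would be such an edge
    too. *)
Lemma wheel_of_edges v s : uniq s -> cycle e s -> odd (size s) -> 3 <= size s ->
  {subset s <= [set w | e v w]} -> #|[set w | e v w]| = size s ->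
  edges e = star v :|: cycle_edges s ->
  deg e v = (n V).-1 /\ odd_cycle_ge5 e ([set: V] :\ v).
Proof.
move=> Us es odds s3 sN Ns Eedges.
have NsE : [set w | e v w] =i s.
  have : [set w in s] == [set w | e v w].
    rewrite eqEcard Ns cardsE (card_uniqP Us) leqnn andbT.
    by apply/subsetP => w; rewrite inE => /sN.
  by move/eqP <- => w; rewrite inE.
have vs : v \notin s by rewrite -NsE inE e_irr.
have sE : [set: V] :\ v =i s.
  move=> x; rewrite !inE andbT; apply/idP/idP => [xv|]; last by apply: contraTneq => ->.
  have /card_gt0P[y] : 0 < deg e x by rewrite ltnW // ltnW // deg_ge3.
  rewrite inE => exy.
  have : [set x; y] \in edges e by apply/edgesP; exists x, y.
  rewrite Eedges => /setUP[|/imsetP[z zs /set2_eq[[->]|[->]]] //]; last by rewrite mem_next.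
  rewrite mem_star; last by apply/edgesP; exists x, y.
  by rewrite !inE eq_sym (negPf xv) -NsE inE e_sym => /eqP->.
have nE : (n V).-1 = size s.
  by rewrite -(card_uniqP Us) -(eq_card sE) /n -cardsT (cardsD1 v) inE.
split; first by rewrite nE -Ns.
exists s; split; last first.
  (* Five vertices force a rim of length at least 4, and oddness excludes 4. *)
  have s4 : 4 <= size s by rewrite -nE -ltnS prednK ?noncomplete_order // (leq_trans _ V4).
  by split=> //; rewrite ltn_neqAle s4 andbT; apply: contraTneq odds => <-.
split=> // x y; rewrite !sE => xs ys.
have vxy : v \notin [set x; y].
  by rewrite !inE negb_or; apply/andP; split; apply: contraNneq vs => ->.
apply/idP/idP => [exy|/orP[] /eqP->]; last 2 first.
- exact: next_cycle.
- by rewrite e_sym next_cycle.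
have xyE : [set x; y] \in edges e by apply/edgesP; exists x, y.
move: (xyE); rewrite Eedges inE mem_star // (negPf vxy) /=.
by case/imsetP=> z _ /set2_eq[[-> ->]|[-> ->]]; rewrite eqxx ?orbT.
Qed.

Lemma dc_edges_star v : {in dc_edges e, forall E : {set V}, v \in E} ->
  2 * #|dc_edges e| <= m e /\
  (2 * #|dc_edges e| = m e ->
     deg e v = (n V).-1 /\ odd_cycle_ge5 e ([set: V] :\ v)).
Proof.
move=> Dv; have [D0|[E ED]] := set_0Vmem (dc_edges e).
  have m0 : 0 < m e.
    rewrite (leq_trans _ (subset_leq_card (star_edges v))) // card_star.
    by rewrite ltnW // ltnW // deg_ge3.
  by rewrite D0 cards0 muln0; split=> // m0E; rewrite -m0E in m0.
have dcE F : F \in dc_edges e -> exists2 w, F = [set v; w] & double_critical e v w.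
  move=> FD; have := Dv F FD; case/dc_edgesP: FD => x [y [-> dxy]] /set2P[->|->].
    by exists y.
  by exists x; rewrite 1?setUC // double_critical_sym.
have [u _] := dcE E ED; rewrite double_criticalE => /andP[_ cu].
(* G - v is not 2-colourable, but becomes so on deleting [u]; hence it contains an odd cycle. *)
have ncv : ~~ colorable e (setT :\ v) 2.
  by apply: contra critical4_uncolorable; apply: colorable_add.
have [s [Us es odds s3 sV]] := odd_cycle_exists e_sym e_irr V2 cu ncv.
have vs : v \notin s by apply/negP => /sV; rewrite !inE eqxx.
pose A := [set w | e v w] :&: [set w in s].
(* If [w] were off [s], the odd cycle would survive in G - v - w. *)
have DA : #|dc_edges e| <= #|A|.
  apply: leq_trans (leq_imset_card (fun w => [set v; w]) _).
  apply/subset_leq_card/subsetP => F /dcE[w ->]; rewrite double_criticalE => /andP[evw cw].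
  apply: imset_f; rewrite !inE evw; apply: contraLR cw => ws.
  apply: (odd_cycle_uncolorable V2 es odds) => x xs.
  by rewrite in_setD1 sV // andbT; apply: contraNneq ws => <-.
have cs : #|[set w in s]| = size s by rewrite cardsE; apply/card_uniqP.
have AN : #|A| <= deg e v by apply/subset_leq_card/subsetIl.
have As : #|A| <= size s by rewrite -cs; apply/subset_leq_card/subsetIr.
have sub : star v :|: cycle_edges s \subset edges e.
  by rewrite subUset star_edges cycle_edges_sub.
have card_sub : #|star v :|: cycle_edges s| = deg e v + size s.
  rewrite cardsU (disjoint_setI0 (star_cycle_disjoint vs)) cards0 subn0.
  by rewrite card_star card_cycle_edges.
have le_m : deg e v + size s <= m e by rewrite -card_sub subset_leq_card.
have le1 : 2 * #|dc_edges e| <= #|A| + #|A| by rewrite addnn -mul2n leq_mul2l.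
have le2 : #|A| + #|A| <= deg e v + size s by rewrite leq_add.
split=> [|Em]; first exact: leq_trans le1 (leq_trans le2 le_m).
(* Equality collapses the chain from [2 * #|dc_edges e|] through [#|A| + #|A|] and
   [deg e v + size s] to [m e], so [A] is both the neighbourhood of [v] and the whole cycle. *)
have le3 : deg e v + size s <= #|A| + #|A| by apply: leq_trans le1; rewrite Em.
have NA : deg e v <= #|A|.
  by rewrite -(leq_add2r #|A|) (leq_trans _ le3) // leq_add2l.
have sA : size s <= #|A|.
  by rewrite -(leq_add2l #|A|) (leq_trans _ le3) // leq_add2r.
apply: (@wheel_of_edges v s) => //.
- have /eqP AE : A == [set w in s] by rewrite eqEcard subsetIr cs.
  by move=> w ws; have : w \in A; [rewrite AE inE | case/setIP].
- by apply/eqP; rewrite eqn_leq (leq_trans NA As) (leq_trans sA AN).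
- apply/esym/eqP; rewrite eqEcard sub card_sub -[#|edges e|]/(m e) -Em.
  exact: leq_trans le1 le2.
Qed.

(** Deleting the hub and a rim vertex leaves a path, so every spoke is double-critical; and spokes
    are half of all edges. *)
Lemma wheel_dc_edges v :
  deg e v = (n V).-1 -> odd_cycle_ge5 e ([set: V] :\ v) -> m e <= 2 * #|dc_edges e|.
Proof.
move=> dv [s [[Us s3 sE sP] [odds s5]]].
have ev w : w != v -> e v w by apply: full_degree; rewrite dv.
have nE : (n V).-1 = size s.
  by rewrite -(card_uniqP Us) -(eq_card sE) /n -cardsT (cardsD1 v) inE.
have starD : star v \subset dc_edges e.
  apply/subsetP => E /imsetP[c]; rewrite inE => evc ->; apply/dc_edgesP.
  exists v, c; split=> //; rewrite double_criticalE evc /=.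
  have cv : c != v by apply: contraTneq evc => ->; rewrite e_irr.
  have cs : c \in s by rewrite -sE !inE cv.
  (* Rotated to start at [c], the cycle leaves the path [p], which is 2-coloured by parity of
     position. *)
  have [i p rs] := rot_to cs.
  have nextE x : next s x = next (c :: p) x by rewrite -rs next_rot.
  have Ucp : uniq (c :: p) by rewrite -rs rot_uniq.
  have sp x : x \in setT :\ v :\ c -> x \in p /\ x \in [set: V] :\ v.
    rewrite in_setD1 => /andP[xc xv]; split=> //.
    by move: xv; rewrite sE -(mem_rot i) rs inE (negPf xc).
  have next_index x y : x \in p -> y \in p -> y = next s x -> index y p = (index x p).+1.
    move=> xp yp; rewrite nextE next_nth inE xp orbT /= ifN; last first.
      by apply: contraTneq xp => <-; case/andP: Ucp.
    move=> yE; have [lt|ge] := ltnP (index x p).+1 (size p).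
      by rewrite yE /= index_uniq //; case/andP: Ucp.
    (* Past the end of [p], [nth] returns its default [c], the cyclic successor of the last vertex;
       but [y] lies in [p]. *)
    by case/andP: Ucp => /negP[]; rewrite -(nth_default c ge) -yE.
  apply/colorable2P => //; exists (fun x => odd (index x p)).
  move=> x y /sp[xp xv] /sp[yp yv]; rewrite sP //.
  by case/orP=> /eqP/next_index -> //=; case: odd.
have sub : edges e \subset star v :|: cycle_edges s.
  apply/subsetP => E EE; rewrite inE mem_star //; apply/orP.
  have [vE|vE] := boolP (v \in E); [by left | right].
  have /edgesP[x [y [Exy exy]]] := EE.
  have [xv yv] : x != v /\ y != v.
    by move: vE; rewrite Exy !inE negb_or ![v == _]eq_sym => /andP[].
  move: exy; rewrite Exy sP ?inE ?xv ?yv // => /orP[] /eqP->.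
    by apply: imset_f; rewrite -sE !inE xv.
  by rewrite setUC; apply: imset_f; rewrite -sE !inE yv.
apply: leq_trans (subset_leq_card sub) _.
rewrite cardsU (leq_trans (leq_subr _ _)) // card_cycle_edges // -nE -dv -card_star.
by rewrite addnn -mul2n leq_mul2l subset_leq_card.
Qed.

End Critical4.

(** * Families of pairwise meeting pairs, and the theorem *)

Lemma intersecting_pairs (T : finType) (D : {set {set T}}) :
  {in D, forall E : {set T}, #|E| = 2} -> {in D &, forall E F : {set T}, ~~ [disjoint E & F]} ->
  (exists v, {in D, forall E : {set T}, v \in E}) \/
  (exists2 A : {set T}, #|A| <= 3 & {in D, forall E : {set T}, E \subset A}).
Proof.
move=> D2 DI; have [->|[E ED]] := set_0Vmem D.
  by right; exists set0 => [|E]; rewrite ?cards0 // inE.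
have meet E1 E2 : E1 \in D -> E2 \in D -> exists2 x, x \in E1 & x \in E2.
  by move=> E1D E2D; have /pred0Pn[x /andP[]] := DI _ _ E1D E2D; exists x.
have /eqP/cards2P[a [b [ab EE]]] := D2 E ED.
have [/forall_inP Da|] := boolP [forall F in D, a \in F]; first by left; exists a.
have [/forall_inP Db|] := boolP [forall F in D, b \in F]; first by left; exists b.
(* [F] misses [a] and [H] misses [b], so meeting [E] puts [b] in [F] and [a] in [H]; their common
   element [c] completes the triangle. *)
rewrite !negb_forall_in => /exists_inP[H HD bH] /exists_inP[F FD aF].
right.
have bF : b \in F.
  by have [x] := meet _ _ ED FD; rewrite EE => /set2P[] -> //; rewrite (negPf aF).
have aH : a \in H.
  by have [x] := meet _ _ ED HD; rewrite EE => /set2P[] -> //; rewrite (negPf bH).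
have [c cF cH] := meet _ _ FD HD.
have ac : a != c by apply: contraNneq aF => ->.
have bc : b != c by apply: contraNneq bH => ->.
have pairE (G : {set T}) x y : G \in D -> x \in G -> y \in G -> x != y -> G = [set x; y].
  move=> GD xG yG xy; apply/esym/eqP; rewrite eqEcard D2 // cards2 xy andbT.
  by apply/subsetP => z /set2P[]->.
have FE := pairE F b c FD bF cF bc; have HE := pairE H a c HD aH cH ac.
exists [set a; b; c].
  by rewrite setUC (leq_trans (leq_card_setU _ _)) // cards1 cards2 ab.
move=> G GD; have /eqP/cards2P[p [q [_ GE]]] := D2 G GD.
(* No element lies in all of [E], [F], [H], so meeting the three takes both elements of [G]. *)
have [x] := meet _ _ GD ED; have [y] := meet _ _ GD FD; have [z] := meet _ _ GD HD.
rewrite GE EE FE HE subUset !sub1set !inE.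
by do 6![case/orP=> /eqP ?]; subst; rewrite ?eqxx ?orbT // in ab ac bc *.
Qed.

Theorem theorem19 (V : finType) (e : rel V)
  (e_sym : symmetric e) (e_irr : irreflexive e) :
  critical4 e -> ~ complete e ->
  2 * #|dc_edges e| <= m e /\
  (2 * #|dc_edges e| = m e <->
     exists v : V, deg e v = (n V).-1 /\ odd_cycle_ge5 e ([set: V] :\ v)).
Proof.
move=> crit nc.
have [le imp] : 2 * #|dc_edges e| <= m e /\ (2 * #|dc_edges e| = m e ->
     exists v : V, deg e v = (n V).-1 /\ odd_cycle_ge5 e ([set: V] :\ v)).
  have [||[v Dv]|[T T3 DT]] := @intersecting_pairs _ (dc_edges e).
  - move=> E /dc_edgesP[x [y [-> /andP[exy _]]]].
    by rewrite cards2 (edge_neq e_irr).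
  - move=> E F /dc_edgesP[x [y [-> xy]]] /dc_edgesP[z [w [-> zw]]].
    have := double_critical_meet e_sym e_irr crit nc xy zw.
    case/or4P=> /eqP E'; apply/pred0Pn; [exists x | exists x | exists y | exists y];
      by rewrite /= !inE E' eqxx ?orbT.
  - by have [le imp] := dc_edges_star e_sym e_irr crit nc Dv; split=> // /imp; exists v.
  - have lt := dc_edges_triangle e_sym e_irr crit nc T3 DT.
    by split=> [|E]; [exact: ltnW | rewrite E ltnn in lt].
split=> //; split=> // -[v [dv wv]]; apply/eqP; rewrite eqn_leq le /=.
exact: (wheel_dc_edges e_sym e_irr crit dv wv).
Qed.
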